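(* For locally compact paracompact non-$\sigma$-compact spaces $X$ and $Y$ the following conditions are equivalent. (1) $(\Omega_X,\subseteq)$ and $(\Omega_Y,\subseteq)$ are order-isomorphic; (2) $\sigma X\setminus X$ and $\sigma Y\setminus Y$ are homeomorphic.
   Context: Compact, locally compact and paracompact spaces are assumed Hausdorff. $C^*(X)$ is the ring of all bounded continuous real-valued functions on $X$. For a Tychonoff space $X$, a sequence $\{U_n\}_{n<\omega}$ is called a $\sigma$-regular sequence of open sets in $X$ if for each $n<\omega$ the set $U_n$ is open in $X$, $\mathrm{cl}_X U_n$ is $\sigma$-compact and non-compact, and $U_n\supseteq\mathrm{cl}_X U_{n+1}$. For a $\sigma$-regular sequence of open sets $\mathcal U=\{U_n\}_{n<\omega}$ in $X$ let $$I_{\mathcal U}=\big\{g\in C^*(X): \text{for any }\epsilon>0,\ |g|^{-1}\big([\epsilon,\infty)\big)\cap\mathrm{cl}_X U_n\text{ is compact for some }n<\omega\big\},$$ and let $\Omega_X=\{I_{\mathcal U}:\mathcal U\text{ is a }\sigma\text{-regular sequence of open sets in }X\}$. $\beta X$ is the Stone-Čech compactification of $X$ and $\sigma X=\bigcup\{\mathrm{cl}_{\beta X}A: A\subseteq X\text{ is }\sigma\text{-compact}\}$. Partially ordered sets are order-isomorphic if there is a bijection between them that is order-preserving with order-preserving inverse. *)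

(* Defs.v *)
From HB Require Import structures.
From mathcomp Require Import all_boot all_order all_algebra.
From mathcomp Require Import all_classical all_reals all_analysis.

Set Implicit Arguments.
Unset Strict Implicit.
Unset Printing Implicit Defensive.

Import Order.TTheory GRing.Theory Num.Theory.
Import numFieldNormedType.Exports.

Local Open Scope classical_set_scope.
Local Open Scope ring_scope.

Definition sigma_compact (T : topologicalType) (A : set T) : Prop :=
  exists2 K : nat -> set T, (forall n, compact (K n)) & A = \bigcup_n K n.

Definition locally_finite (T : topologicalType) (V : set (set T)) : Prop :=
  forall x : T, exists2 N : set T, nbhs x N &
    finite_set [set B | V B /\ B `&` N !=set0].

(* Paracompact spaces are Hausdorff by convention. *)
Definition paracompact (T : topologicalType) : Prop :=
  hausdorff_space T /\
  forall U : set (set T), U `<=` open -> \bigcup_(A in U) A = [set: T] ->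
    exists V : set (set T),
      [/\ V `<=` open,
          \bigcup_(B in V) B = [set: T],
          (forall B, V B -> exists2 A, U A & B `<=` A) &
          locally_finite V].

Definition homeomorphic (S T : topologicalType) : Prop :=
  exists (f : S -> T) (g : T -> S),
    [/\ cancel f g, cancel g f, continuous f & continuous g].

Definition order_isomorphic (S T : Type)
    (leS : S -> S -> Prop) (leT : T -> T -> Prop) : Prop :=
  exists (f : S -> T) (g : T -> S),
    [/\ cancel f g, cancel g f,
        (forall a b, leS a b -> leT (f a) (f b)) &
        (forall a b, leT a b -> leS (g a) (g b))].

Definition Cstar (R : realType) (X : topologicalType) : set (X -> R) :=
  [set f | continuous f /\ bounded_fun f].
Arguments Cstar : clear implicits.

Definition sigma_regular (X : topologicalType) (U : nat -> set X) : Prop :=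
  forall n, [/\ open (U n),
                sigma_compact (closure (U n)),
                ~ compact (closure (U n)) &
                closure (U n.+1) `<=` U n].

Definition ideal_of (R : realType) (X : topologicalType) (U : nat -> set X) :
    set (X -> R) :=
  [set g | Cstar R X g /\
     forall e : R, 0 < e ->
       exists n, compact ([set x | e <= `|g x|] `&` closure (U n))].

Definition Omega (R : realType) (X : topologicalType) : set (set (X -> R)) :=
  [set I | exists2 U : nat -> set X, sigma_regular U & I = ideal_of U].
Arguments Omega : clear implicits.

Definition Omega_le (R : realType) (X : topologicalType) (I J : Omega R X) :
  Prop := set_val I `<=` set_val J.

Section StoneCech.
Context (R : realType) (X : topologicalType).

(* beta X is the closure of the image of X under the evaluation map into the
   product of copies of R indexed by C*(X).  For Tychonoff X this is the
   Stone-Cech compactification, by the lemmas at the end of this section. *)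
Definition ev (x : X) : {ptws (Cstar R X) -> R} := fun f => set_val f x.

Definition beta : Type := set_type (closure (range ev)).
HB.instance Definition _ := Topological.on beta.

Definition beta_emb (x : X) : beta :=
  exist _ (ev x) (mem_set (@subset_closure _ (range ev) (ev x) (imageT ev x))).

Definition sigma_ext : set beta :=
  \bigcup_(A in [set A : set X | sigma_compact A]) closure (beta_emb @` A).

Definition sigma_remainder : set beta := sigma_ext `\` range beta_emb.

Let val_continuous : continuous (set_val : beta -> {ptws (Cstar R X) -> R}).
Proof. exact: initial_continuous. Qed.

Lemma beta_hausdorff : hausdorff_space beta.
Proof.
move=> p q pq; apply: val_inj.
apply: (@hausdorff_product _ (fun=> R) (fun=> @Rhausdorff R)) => A B pA qB.
have [r [Ar Br]] := pq _ _ (val_continuous pA) (val_continuous qB).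
by exists (set_val r).
Qed.

Lemma beta_compact : compact [set: beta].
Proof.
have cl : compact (closure (range ev)).
  have bd (f : Cstar R X) : exists M : R, forall x, `|set_val f x| <= M.
    by have /set_mem[_ /ex_strict_bound_gt0[M _ Mf]] := valP f;
      exists M => x; exact/ltW/Mf.
  pose M f := projT1 (cid (bd f)).
  have cB : compact [set g : {ptws (Cstar R X) -> R} |
      forall f, `[- M f, M f]%classic (g f)].
    exact: (@tychonoff _ (fun=> R) _ (fun f => @segment_compact R _ _)).
  apply: (subclosed_compact _ cB); first exact: closed_closure.
  rewrite [X in _ `<=` X](closure_id _).1; last first.
    apply: compact_closed cB.
    exact: (@hausdorff_product _ (fun=> R) (fun=> @Rhausdorff R)).
  apply: closureS => _ [x _ <-] f /=; rewrite in_itv/= -ler_norml.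
  exact: (projT2 (cid (bd f))).
move=> F PF _.
have Fcl : (set_val @ F) (closure (range ev)).
  suff: F (set_val @^-1` closure (range ev)) by [].
  by apply: filterS filterT => z _; exact: set_valP.
have [p [cp clp]] := cl (set_val @ F) _ Fcl.
exists (exist _ p (mem_set cp) : beta); split=> // A B FA.
move=> [_ [[C oC <-] /= Cp CB]].
have [_ [[r Ar <-] Cr]] : (set_val @` A) `&` C !=set0.
  apply: clp; first suff: F (set_val @^-1` (set_val @` A)) by [].
    by apply: filterS FA => z Az; exists z.
  exact: open_nbhs_nbhs.
by exists r; split=> //; exact: CB.
Qed.

Lemma beta_emb_dense : closure (range beta_emb) = [set: beta].
Proof.
apply/seteqP; split=> // p _ B [_ [[C oC <-] /= Cp CB]].
have [_ [[x _ <-] Cx]] := set_valP p _ (open_nbhs_nbhs (conj oC Cp)).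
by exists (beta_emb x); split; [exists x|exact: CB].
Qed.

Lemma beta_extension (f : X -> R) : Cstar R X f ->
  exists2 g : beta -> R, continuous g & g \o beta_emb = f.
Proof.
move=> Cf; pose i : Cstar R X := exist _ f (mem_set Cf).
exists (fun p => (set_val p : {ptws (Cstar R X) -> R}) i) => // p.
apply: (@continuous_comp _ {ptws (Cstar R X) -> R} R set_val (fun h => h i)).
  exact: val_continuous.
exact: (@proj_continuous _ (fun=> R) i).
Qed.

Let sep : completely_regular_space X ->
  @separate_points_from_closed (Cstar R X) X (fun=> R) (fun f => set_val f).
Proof.
move=> crX U x cU Ux.
have /(@uniform_separatorP _ R)[f [cf f01 fx fU]] := crX x U cU Ux.
have Cf : Cstar R X f.
  split=> //; exists 1; split=> // M M1 y _ /=.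
  have /f01 : range f (f y) by exists y.
  rewrite /= in_itv/= => /andP[f0 f1].
  by rewrite ger0_norm// (le_trans f1)// ltW.
exists (exist _ f (mem_set Cf)) => /=.
rewrite set_valE /= (_ : f x = 0); last by apply: fx; exists x.
move=> /(closureS fU); rewrite -(closure_id _).1.
  by move=> /esym/eqP; rewrite oner_eq0.
exact: accessible_closed_set1 (hausdorff_accessible (@Rhausdorff R)) 1.
Qed.

Lemma beta_emb_inj :
  completely_regular_space X -> hausdorff_space X -> injective beta_emb.
Proof.
move=> /sep crX hX x y /(congr1 set_val) xy.
by apply: (join_product_inj crX (hausdorff_accessible hX)); rewrite ?inE.
Qed.

Lemma beta_emb_openE :
  completely_regular_space X -> hausdorff_space X ->
  @open X = [set beta_emb @^-1` B | B in @open beta].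
Proof.
move=> /sep crX hX.
have cts (f : Cstar R X) : continuous (set_val f) by have /set_mem[] := valP f.
rewrite (join_product_initial crX cts); last first.
  exact: join_product_inj crX (hausdorff_accessible hX).
apply/seteqP; split=> [_ [A oA <-]|_ [_ [A oA <-] <-]]; last by exists A.
by exists (set_val @^-1` A) => //; exists A.
Qed.

End StoneCech.
Arguments beta : clear implicits.
Arguments sigma_ext : clear implicits.
Arguments sigma_remainder : clear implicits.

(* Main.v *)
Require Import Defs.
From HB Require Import structures.
From mathcomp Require Import all_boot all_order all_algebra.
From mathcomp Require Import all_classical all_reals all_analysis.
From mathcomp Require Import borel_hierarchy.

(** The idea is to translate both sides into the family of nonempty compact
    G-delta sets of the remainder S of sigma X, ordered by inclusion.

    Let e embed X in its Stone-Cech compactification, and let U be a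
    sigma-regular sequence. Its trace, the intersection of the closures of the
    e (U n) with X removed, is a nonempty compact subset of S, and the ideal
    of U consists of the functions whose continuous extension vanishes on the
    trace ([ideal_of_vanishing]). The trace is a G-delta set because X is
    normal ([compact_Gdelta_remainder_trace]), and every nonempty compact
    G-delta set of S is a trace ([compact_Gdelta_is_remainder_trace]); the
    latter rests on sigma X being open, because every sigma-compact subset
    of X lies in a sigma-compact clopen one ([sigma_compact_clopen]). By
    Urysohn's lemma a closed set is determined by its vanishing ideal, so
    Omega X is anti-isomorphic to the family of nonempty compact G-delta sets
    of S ([Omega_compact_Gdelta]).

    A homeomorphism clearly preserves this family. Conversely, S is locally
    compact Hausdorff, and such a space is determined by the ordered family
    ([compact_Gdelta_homeomorphic]): under an order isomorphism, the images of
    the sets that contain a point p are compact and directed, so they share a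
    point, and this point is unique since compact G-delta sets separate
    points. The resulting bijection is a homeomorphism because compact G-delta
    sets are closed, give compact neighbourhoods, and cut out compact sets
    from points outside them. *)

Set Implicit Arguments.
Unset Strict Implicit.
Unset Printing Implicit Defensive.

Import Order.TTheory GRing.Theory Num.Theory.
Import numFieldNormedType.Exports.

Local Open Scope classical_set_scope.
Local Open Scope ring_scope.

(** * Compact sets and locally compact spaces *)

(** Otherwise the sets whose complement in K has the property P form a proper
    filter, and a cluster point of it in K contradicts the local assumption. This
    induction replaces the extraction of finite subcovers. *)
Lemma compact_ind (T : topologicalType) (K : set T) (P : set T -> Prop) :
  compact K -> P set0 -> (forall A B, P A -> P B -> P (A `|` B)) ->
  (forall A B, A `<=` B -> P B -> P A) ->
  (forall x, K x -> exists2 U, nbhs x U & P U) -> P K.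
Proof.
move=> cK P0 PU PS Pl; apply: contrapT => nPK.
pose F : set_system T := [set A | P (K `\` A)].
have FF : ProperFilter F.
  split; first by rewrite /F /= setD0.
  split; rewrite /F /=; first by rewrite setDT.
  - by move=> A B FA FB; apply: PS (PU _ _ FA FB); rewrite -setDIr.
  - by move=> A B AB; apply: PS; exact: setDS.
have [|x [Kx clx]] := cK F FF; first by rewrite /F /= setDv.
have [U Ux PU'] := Pl x Kx.
have /clx/(_ Ux)[y []//] : F (~` U).
by rewrite /F /= setDE setCK; apply: PS PU'; exact: subIsetr.
Qed.

Lemma open_forall_nbhs (T : topologicalType) (A : set T) :
  (forall x, A x -> nbhs x A) -> open A.
Proof. by move=> An; rewrite openE => x /An. Qed.

Lemma locally_compact_nbhs (T : topologicalType) (x : T) :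
  hausdorff_space T -> locally_compact [set: T] ->
  exists2 K : set T, nbhs x K & compact K.
Proof.
move=> hT lcT; have [K Kx [cK _]] := lcT x I.
by exists K => //; move: Kx; rewrite within_interior ?interiorT.
Qed.

(** Near a single point this is regularity together with a compact
    neighbourhood; the conclusion is stable under finite unions, so it extends
    to compact sets. *)
Lemma compact_shrink (T : topologicalType) (C O : set T) :
  hausdorff_space T -> locally_compact [set: T] ->
  compact C -> open O -> C `<=` O ->
  exists V, [/\ open V, C `<=` V, closure V `<=` O & compact (closure V)].
Proof.
move=> hT lcT cC oO CO.
pose P A := exists V, [/\ open V, A `<=` V, closure V `<=` O
  & compact (closure V)].
apply: (compact_ind (P := P) cC) => [|A B|A B AB|x Cx].
- exists set0; rewrite closure0; split => //; first exact: open0.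
  exact: compact0.
- move=> [V [oV AV VO cV]] [W [oW BW WO cW]]; exists (V `|` W); split.
  + exact: openU.
  + exact: setUSS.
  + by rewrite closureU subUset.
  + by rewrite closureU; exact: compactU.
- by move=> [V [oV BV VO cV]]; exists V; split=> //; exact: subset_trans BV.
- have [K Kx cK] := locally_compact_nbhs x hT lcT.
  have OKx : nbhs x (O `&` K).
    by apply: filterI => //; apply: open_nbhs_nbhs; split=> //; exact: CO.
  have [U Ux UOK] := compact_regular hT cK Kx OKx.
  exists U°; first exact: nbhs_interior.
  exists U°.
  have UU : closure U° `<=` O `&` K.
    by apply: subset_trans UOK; apply: closureS; exact: interior_subset.
  split => //; first exact: open_interior.
    by move=> z /UU[].
  by apply: (subclosed_compact _ cK); [exact: closed_closure|move=> z /UU[]].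
Qed.

(** In a locally compact Hausdorff space these are the nonempty compact zero
    sets; writing them as countable intersections of open sets makes their
    invariance under homeomorphisms immediate. *)
Definition compact_Gdelta (T : topologicalType) : set (set T) :=
  [set Z | [/\ Z !=set0, compact Z & Gdelta Z]].
Arguments compact_Gdelta : clear implicits.

(** Iterated shrinking around a compact set. The two inclusions of the closures
    force the intersection of the V n to be that of their closures and to lie in
    every W n. *)
Lemma shrinking_sequence (T : topologicalType) (C : set T) (W : nat -> set T) :
  hausdorff_space T -> locally_compact [set: T] ->
  compact C -> (forall n, open (W n)) -> (forall n, C `<=` W n) ->
  exists V : nat -> set T, forall n,
   [/\ open (V n), C `<=` V n, closure (V n) `<=` W n, compact (closure (V n)) &
       closure (V n.+1) `<=` V n].
Proof.
move=> hT lcT cC oW CW.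
(* The hypotheses on D are moved inside the existential so that the choice is a
   total function, which can be iterated. *)
have step (D : set T) (n : nat) : exists V, open D -> C `<=` D ->
    [/\ open V, C `<=` V, closure V `<=` D `&` W n & compact (closure V)].
  have [[oD CD]|nD] := pselect (open D /\ C `<=` D); last first.
    by exists set0 => oD CD; case: nD.
  have [V HV] := compact_shrink hT lcT cC (openI oD (oW n))
    (fun x Cx => conj (CD x Cx) (CW n x Cx)).
  by exists V.
pose s D n := projT1 (cid (step D n)).
have sP D n := projT2 (cid (step D n)); rewrite -/(s _ _) in sP.
pose V := fix V n := if n is m.+1 then s (V m) m.+1 else s setT 0%N.
have VP n : [/\ open (V n), C `<=` V n, closure (V n) `<=` W n
    & compact (closure (V n))].
  elim: n => [|n [oV CV _ _]].
    have [//|//|oV CV VW cV] := sP setT 0%N; first exact: openT.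
    by split=> // x /VW[].
  have [//|//|oV' CV' VW cV] := sP (V n) n.+1.
  by split=> // x /VW[].
exists V => n; have [oV CV VW cV] := VP n; split => //.
by have [//|//|_ _ + _] := sP (V n) n.+1 => + x Vx => /(_ x Vx)[].
Qed.

(** The abundance of compact G-delta sets: they separate points and give
    compact neighbourhoods, which is all that is needed to recover a locally
    compact space from them. *)
Lemma compact_Gdelta_between (T : topologicalType) (C O : set T) :
  hausdorff_space T -> locally_compact [set: T] ->
  C !=set0 -> compact C -> open O -> C `<=` O ->
  exists2 Z, compact_Gdelta T Z & C `<=` Z /\ Z `<=` O.
Proof.
move=> hT lcT [x Cx] cC oO CO.
have [V VP] := shrinking_sequence hT lcT cC (fun _ : nat => oO) (fun=> CO).
have VE : \bigcap_n V n = \bigcap_n closure (V n).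
  apply/seteqP; split=> [y Vy n _|y Vy n _]; first exact/subset_closure/Vy.
  by have [_ _ _ _] := VP n; apply; exact: Vy.
exists (\bigcap_n V n).
  split; first by exists x => n _; have [_ + _ _ _] := VP n; exact.
    rewrite VE; have [_ _ _ cV _] := VP 0%N; apply: (subclosed_compact _ cV).
      by apply: closed_bigI => n _; exact: closed_closure.
    by move=> y; exact.
  by exists V => // n; have [] := VP n.
split=> y Vy; first by move=> n _; have [_ + _ _ _] := VP n; exact.
by have [_ _ VO _ _] := VP 0%N; apply/VO/subset_closure/Vy.
Qed.

(** When the topology of S is induced by f, a cluster point of an image filter
    lifts to a cluster point of the filter itself. *)
Lemma compact_image_initial (S T : topologicalType) (f : S -> T) (Z : set S) :
  (forall x N, nbhs x N -> exists2 D, nbhs (f x) D & f @^-1` D `<=` N) ->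
  compact (f @` Z) -> compact Z.
Proof.
move=> fN cZ F FF FZ.
have FZ' : (f @ F) (f @` Z).
  suff: F (f @^-1` (f @` Z)) by [].
  by apply: filterS FZ => z Zz; exists z.
have [_ [[z Zz <-] clz]] := cZ (f @ F) _ FZ'.
exists z; split=> // B C FB /fN[D Dz DC].
have [|_ [[w Bw <-] Dw]] := clz (f @` B) D _ Dz.
  suff: F (f @^-1` (f @` B)) by [].
  by apply: filterS FB => w Bw; exists w.
by exists w; split => //; exact: DC.
Qed.

Lemma compact_set_val (T : topologicalType) (A : set T) (Z : set A) :
  compact Z <-> compact (set_val @` Z).
Proof.
split=> [cZ|].
  apply: continuous_compact cZ; apply: continuous_subspaceT.
  exact: initial_continuous.
apply: compact_image_initial => x N [_ [[D oD <-] /= Dx DN]].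
by exists D => //; exact: open_nbhs_nbhs.
Qed.

Lemma set_val_imageK (T : Type) (A K : set T) : K `<=` A ->
  set_val @` (set_val @^-1` K : set A) = K.
Proof.
move=> KA; apply/seteqP; split=> [_ [z Kz <-]//|x Kx].
by exists (exist _ x (mem_set (KA x Kx))).
Qed.

Lemma hausdorff_set_val (T : topologicalType) (A : set T) :
  hausdorff_space T -> hausdorff_space A.
Proof.
move=> hT p q pq; apply: val_inj; apply: hT => B C Bp Cq.
have [//||r [Br Cr]] := pq (set_val @^-1` B) (set_val @^-1` C).
- exact: initial_continuous.
- exact: initial_continuous.
- by exists (set_val r).
Qed.

(** * Order isomorphisms between families of sets *)

(** Packs a point of P as an element of the subtype; the predicate is spelled
    out because unification cannot guess it. *)
Definition member (T : Type) (P : set T) (x : T) (Px : P x) : P :=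
  exist (fun y => y \in P) x (mem_set Px).

Definition sub_le (T : Type) (P : set (set T)) (A B : P) : Prop :=
  set_val A `<=` set_val B.

Lemma order_isomorphic_sym (S T : Type) leS leT :
  @order_isomorphic S T leS leT -> order_isomorphic leT leS.
Proof. by move=> [f [g [fK gK fm gm]]]; exists g, f. Qed.

Lemma order_isomorphic_trans (S T U : Type) leS leT leU :
  @order_isomorphic S T leS leT -> @order_isomorphic T U leT leU ->
  order_isomorphic leS leU.
Proof.
move=> [f [g [fK gK fm gm]]] [f' [g' [fK' gK' fm' gm']]].
exists (f' \o f), (g \o g'); split=> [x|x|a b /fm/fm'//|a b /gm'/gm//] /=.
  by rewrite fK' fK.
by rewrite gK gK'.
Qed.

Lemma order_isomorphic_dual (S T : Type) leS leT :
  @order_isomorphic S T leS leT ->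
  order_isomorphic (fun a b => leS b a) (fun a b => leT b a).
Proof.
move=> [f [g [fK gK fm gm]]].
by exists f, g; split=> // a b; [exact: fm|exact: gm].
Qed.

Lemma sub_le_anti (T : Type) (P : set (set T)) (A B : P) :
  sub_le A B -> sub_le B A -> A = B.
Proof. by move=> AB BA; apply: val_inj; apply/seteqP. Qed.

(** A parametrization that reverses and reflects inclusion is injective by
    antisymmetry, so its inverse can be chosen. *)
Lemma antitone_image_isomorphic (S T : Type) (P : set (set S)) (Q : set (set T))
    (phi : set S -> set T) :
  Q = phi @` P ->
  (forall A B, P A -> P B -> (phi A `<=` phi B <-> B `<=` A)) ->
  order_isomorphic (@sub_le _ P) (fun A B : Q => sub_le B A).
Proof.
move=> QE phiP.
have fQ (A : P) : Q (phi (set_val A)).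
  by rewrite QE; exists (set_val A) => //; exact: set_valP.
have gQ (B : Q) : exists2 A, P A & phi A = set_val B.
  by have := set_valP B; rewrite {1}QE.
pose f (A : P) : Q := member (fQ A).
pose g (B : Q) : P := member (s2valP (cid2 (gQ B))).
have fg B : set_val (f (g B)) = set_val B by exact: (s2valP' (cid2 (gQ B))).
have fE A B : sub_le (f B) (f A) <-> sub_le A B.
  by apply: phiP; exact: set_valP.
have gK : cancel g f by move=> B; apply: val_inj; exact: fg.
exists f, g; split => [A|//|A B /fE//|A B AB]; last by apply/fE; rewrite !gK.
by apply: sub_le_anti; apply/fE; rewrite gK.
Qed.

(** * A locally compact space is determined by its compact G-delta sets *)

Lemma preimage_cancel (S T : Type) (f : S -> T) (g : T -> S) (A : set S) :
  cancel f g -> cancel g f -> g @^-1` A = f @` A.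
Proof.
move=> fK gK; apply/seteqP; split=> [y Ay|_ [x Ax <-] /=]; last by rewrite fK.
by exists (g y).
Qed.

Lemma compact_Gdelta_preimage (S T : topologicalType) (f : S -> T) (g : T -> S)
    (Z : set S) :
  cancel f g -> cancel g f -> continuous f -> continuous g ->
  compact_Gdelta S Z -> compact_Gdelta T (g @^-1` Z).
Proof.
move=> fK gK cf cg [[x Zx] cZ [W oW ZE]]; split.
- by exists (f x) => /=; rewrite fK.
- rewrite (preimage_cancel _ fK gK); apply: continuous_compact cZ.
  exact: continuous_subspaceT.
- exists (fun n => g @^-1` W n); last by rewrite ZE preimage_bigcap.
  by move=> n; apply: open_comp => // y _; exact: cg.
Qed.

Lemma homeomorphic_compact_Gdelta (S T : topologicalType) : homeomorphic S T ->
  order_isomorphic (@sub_le _ (compact_Gdelta S))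
                   (@sub_le _ (compact_Gdelta T)).
Proof.
move=> [f [g [fK gK cf cg]]].
pose F (A : compact_Gdelta S) : compact_Gdelta T :=
  member (compact_Gdelta_preimage fK gK cf cg (set_valP A)).
pose G (B : compact_Gdelta T) : compact_Gdelta S :=
  member (compact_Gdelta_preimage gK fK cg cf (set_valP B)).
exists F, G; split=> [A|B|A B AB x|A B AB x]; [| |exact: AB|exact: AB].
- by apply: val_inj; apply/funext => x /=; rewrite /preimage /= fK.
- by apply: val_inj; apply/funext => x /=; rewrite /preimage /= gK.
Qed.

(** The members of the family that contain p are stable under intersection, so
    their images under a monotone map form a filter base of nonempty compact
    sets, and such a base has a common point. *)
Lemma point_of_images (S T : topologicalType)
    (F : compact_Gdelta S -> compact_Gdelta T) :
  hausdorff_space S -> locally_compact [set: S] -> hausdorff_space T ->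
  (forall A B, sub_le A B -> sub_le (F A) (F B)) ->
  forall p, exists q, forall Z, set_val Z p -> set_val (F Z) q.
Proof.
move=> hS lcS hT Fm p.
have [Z0 Z0p] : exists Z : compact_Gdelta S, set_val Z p.
  have [Z cZ [pZ _]] := compact_Gdelta_between hS lcS (ex_intro _ p erefl)
    (@compact_set1 _ p) openT (@subsetT _ _).
  by exists (member cZ); exact: pZ.
pose D : set (compact_Gdelta S) := [set Z | set_val Z p].
pose FF := filter_from D (fun Z => set_val (F Z)).
have FFP : ProperFilter FF.
  apply: filter_from_proper; last by move=> Z _; have [] := set_valP (F Z).
  apply: filter_from_filter; first by exists Z0.
  move=> A B Ap Bp.
  have cAB : compact_Gdelta S (set_val A `&` set_val B).
    have [_ cA [V oV AE]] := set_valP A; have [_ cB [W oW BE]] := set_valP B.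
    split; first by exists p.
      by apply: compact_closedI => //; exact: compact_closed.
    exists (fun n => V n `&` W n); first by move=> n; exact: openI.
    by rewrite bigcapI -AE -BE.
  exists (member cAB); first by split.
  by move=> x Fx; split; apply: Fm Fx => y [].
have [_ cF _] := set_valP (F Z0).
have [|q [_ clq]] := cF FF FFP; first by exists Z0.
exists q => Z Zp; have [_ cFZ _] := set_valP (F Z).
by apply: (compact_closed hT cFZ) => B /clq; apply; exists Z.
Qed.

Lemma compact_Gdelta_separate (S : topologicalType) (p p' : S) :
  hausdorff_space S -> locally_compact [set: S] ->
  (forall Z : compact_Gdelta S, set_val Z p -> set_val Z p') -> p = p'.
Proof.
move=> hS lcS sep; apply: contrapT => pp'.
have op : open (~` [set p']).
  exact/closed_openC/accessible_closed_set1/hausdorff_accessible.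
have [Z cZ [pZ Zp']] := compact_Gdelta_between hS lcS
  (ex_intro _ p erefl) (@compact_set1 _ p) op
  (fun x (xp : x = p) (xp' : x = p') => pp' (etrans (esym xp) xp')).
apply: (Zp' p') => //; apply: (sep (member cZ)); exact: pZ.
Qed.

(** Applied to F and then to G, [point_of_images] takes p to q and q
    to a point p' lying in every set that contains p; separation gives p = p',
    which upgrades the implication to an equivalence. *)
Lemma point_map (S T : topologicalType)
    (F : compact_Gdelta S -> compact_Gdelta T) G :
  hausdorff_space S -> locally_compact [set: S] ->
  hausdorff_space T -> locally_compact [set: T] ->
  cancel F G -> cancel G F ->
  (forall A B, sub_le A B -> sub_le (F A) (F B)) ->
  (forall A B, sub_le A B -> sub_le (G A) (G B)) ->
  forall p, exists q, forall Z, set_val Z p <-> set_val (F Z) q.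
Proof.
move=> hS lcS hT lcT FK GK Fm Gm p.
have [q pq] := point_of_images hS lcS hT Fm p.
exists q => Z; split; first exact: pq.
have [p' qp'] := point_of_images hT lcT hS Gm q.
have pp' : p = p'.
  by apply: compact_Gdelta_separate => // Z' /pq/qp'; rewrite FK.
by move=> /qp'; rewrite FK -pp'.
Qed.

(** A neighbourhood W of h p is recovered as follows: inside the image of a
    compact neighbourhood Z of p, the part outside W is compact and misses h p,
    so it is covered by some B of the family that misses h p. Its preimage is
    the set G B, which is closed and misses p, and Z minus G B is mapped into
    W. *)
Lemma point_map_continuous (S T : topologicalType)
    (F : compact_Gdelta S -> compact_Gdelta T) G (h : S -> T) :
  hausdorff_space S -> locally_compact [set: S] ->
  hausdorff_space T -> locally_compact [set: T] ->
  cancel G F ->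
  (forall p Z, set_val Z p <-> set_val (F Z) (h p)) -> continuous h.
Proof.
move=> hS lcS hT lcT GK hP p V; rewrite nbhsE => -[W [oW Wh] WV].
have [K Kp cK] := locally_compact_nbhs p hS lcS.
have [Z cZ [KZ _]] := compact_Gdelta_between hS lcS
  (ex_intro _ p (nbhs_singleton Kp)) cK openT (@subsetT _ _).
pose Z' : compact_Gdelta S := member cZ.
have Zp : nbhs p Z by apply: filterS Kp.
have [_ cFZ _] := set_valP (F Z').
pose C := set_val (F Z') `&` ~` W.
have cC : compact C by apply: compact_closedI => //; exact: open_closedC.
have hZ x : Z x -> set_val (F Z') (h x) by move=> Zx; exact/(hP x Z').
have [C0|/set0P C0] := eqVneq C set0.
  apply: filterS Zp => x /hZ Fx; apply: WV; apply: contrapT => nW.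
  by have : C (h x) by []; rewrite C0.
have oh : open (~` [set h p]).
  exact/closed_openC/accessible_closed_set1/hausdorff_accessible.
have Ch : C `<=` ~` [set h p] by move=> y [_ nWy] /= yh; apply: nWy; rewrite yh.
have [B cB [CB Bp]] := compact_Gdelta_between hT lcT C0 cC oh Ch.
pose B' : compact_Gdelta T := member cB.
have [_ cG _] := set_valP (G B').
have nGp : ~ set_val (G B') p by move/hP; rewrite GK => /Bp; exact.
have nG : nbhs p (~` set_val (G B')).
  apply: open_nbhs_nbhs; split=> //; apply/closed_openC.
  exact: compact_closed.
apply: filterS (filterI Zp nG) => x [/hZ Zx nGx].
apply: WV; apply: contrapT => nW; apply: nGx; apply/hP; rewrite GK.
exact: CB.
Qed.

Lemma compact_Gdelta_homeomorphic (S T : topologicalType) :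
  hausdorff_space S -> locally_compact [set: S] ->
  hausdorff_space T -> locally_compact [set: T] ->
  order_isomorphic (@sub_le _ (compact_Gdelta S))
                   (@sub_le _ (compact_Gdelta T)) ->
  homeomorphic S T.
Proof.
move=> hS lcS hT lcT [F [G [FK GK Fm Gm]]].
have HF p := cid (point_map hS lcS hT lcT FK GK Fm Gm p).
have HG q := cid (point_map hT lcT hS lcS GK FK Gm Fm q).
pose h p := sval (HF p); pose k q := sval (HG q).
have hP p Z : set_val Z p <-> set_val (F Z) (h p) by exact: (svalP (HF p)).
have kP q Z : set_val Z q <-> set_val (G Z) (k q) by exact: (svalP (HG q)).
exists h, k; split.
- by move=> p; apply/esym/compact_Gdelta_separate => // Z /hP/kP; rewrite FK.
- by move=> q; apply/esym/compact_Gdelta_separate => // Z /kP/hP; rewrite GK.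
- exact: (point_map_continuous hS lcS hT lcT GK hP).
- exact: (point_map_continuous hT lcT hS lcS FK kP).
Qed.

(** * Sigma-compact sets in locally compact paracompact spaces *)

Lemma countable_compacts_sigma (T : topologicalType) (I : Type) (D : set I)
    (F : I -> set T) :
  countable D -> (forall i, D i -> compact (F i)) ->
  sigma_compact (\bigcup_(i in D) F i).
Proof.
move=> /countable_injP[h hinj] cF.
have K_ n : exists K : set T, compact K /\
    forall x, K x <-> exists2 i, D i /\ h i = n & F i x.
  have [[i [Di hi]]|nD] := pselect (exists i, D i /\ h i = n).
    exists (F i); split; first exact: cF.
    move=> x; split=> [Fx|[j [Dj hj] Fjx]]; first by exists i.
    by rewrite (hinj i j) ?inE// hi hj.
  (* n is not the index of any member of D *)
  exists set0; split; first exact: compact0.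
  by move=> x; split=> // -[i iD _]; apply: nD; exists i.
pose K n := projT1 (cid (K_ n)).
have [cK KE] : (forall n, compact (K n)) /\
    forall n x, K n x <-> exists2 i, D i /\ h i = n & F i x.
  by split=> n; have [] := projT2 (cid (K_ n)).
exists K => //; apply/seteqP; split=> [x [i Di Fx]|x [n _ /KE[i [Di _] Fx]]].
  by exists (h i) => //; apply/KE; exists i.
by exists i.
Qed.

Lemma sigma_compact_bigcup (T : topologicalType) (D : nat -> set T) :
  (forall n, sigma_compact (D n)) -> sigma_compact (\bigcup_n D n).
Proof.
move=> sD; have K_ n := cid2 (sD n).
pose K (p : nat * nat) := s2val (K_ p.1) p.2.
rewrite (_ : \bigcup_n D n = \bigcup_(p in setT) K p).
  apply: countable_compacts_sigma => [|p _]; first exact: countableP.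
  exact: (s2valP (K_ p.1)).
apply/seteqP; split=> [x [n _]|x [[n m] _ Kx]].
  by rewrite (s2valP' (K_ n)) => -[m _ Kx]; exists (n, m).
by exists n => //; rewrite (s2valP' (K_ n)); exists m.
Qed.

Lemma sigma_compact_closedI (T : topologicalType) (A C : set T) :
  sigma_compact A -> closed C -> C `<=` A -> sigma_compact C.
Proof.
move=> [K cK AE] clC CA; exists (fun n => K n `&` C).
  by move=> n; exact: compact_closedI.
rewrite -setI_bigcupl -AE; apply/seteqP; split=> [x Cx|x []//].
by split => //; exact: CA.
Qed.

Lemma locally_finite_meets_compact (T : topologicalType) (V : set (set T)) K :
  locally_finite V -> compact K -> finite_set [set B | V B /\ B `&` K !=set0].
Proof.
move=> lfV cK.
pose P A := finite_set [set B | V B /\ B `&` A !=set0].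
apply: (compact_ind (P := P) cK).
- rewrite /P (_ : mkset _ = set0) //; apply/seteqP; split=> // B [_ [x []]//].
- move=> A B fA fB.
  apply: (@sub_finite_set _ _ ([set C | V C /\ C `&` A !=set0] `|`
    [set C | V C /\ C `&` B !=set0])); last by rewrite finite_setU.
  by move=> C [VC [x [Cx [Ax|Bx]]]]; [left|right]; split => //; exists x.
- move=> A B AB; apply: sub_finite_set => C [VC [x [Cx Ax]]].
  by split=> //; exists x; split=> //; exact: AB.
- by move=> x _; have [N Nx fN] := lfV x; exists N.
Qed.

Section paracompact.
Variable X : topologicalType.
Hypotheses (lcX : locally_compact [set: X]) (pcX : paracompact X).

Let hX : hausdorff_space X := proj1 pcX.

Lemma locally_compact_regular : regular_space X.
Proof.
move=> x; have [K Kx cK] := locally_compact_nbhs x hX lcX.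
exact: compact_regular hX cK Kx.
Qed.

(** Refine the cover made of the complement of A and of the open sets whose
    closure stays in C. The members of the refinement that meet A have closure
    in C, and near any point only finitely many of them matter, so the closure
    of their union stays in C as well. *)
Lemma paracompact_normal : normal_space X.
Proof.
move=> A clA B /set_nbhsP[C [oC AC CB]].
pose U := [set W | open W /\ closure W `<=` C] `|` [set ~` A].
have [V [oV cV VU lfV]] : exists V : set (set X),
    [/\ V `<=` open, \bigcup_(B in V) B = [set: X],
    (forall B, V B -> exists2 A, U A & B `<=` A) & locally_finite V].
  apply: (proj2 pcX) => [W [[]//|->]|]; first exact: closed_openC.
  apply/seteqP; split=> // x _; have [Ax|nAx] := pselect (A x); last first.
    by exists (~` A) => //; right.
  have /locally_compact_regular[W Wx WC] : nbhs x C.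
    by apply: open_nbhs_nbhs; split=> //; exact: AC.
  exists W°; last exact: nbhs_singleton (nbhs_interior Wx).
  left; split; first exact: open_interior.
  by apply: subset_trans WC; apply/closureS; exact: interior_subset.
pose VA := [set D | V D /\ D `&` A !=set0].
have VAC D : VA D -> closure D `<=` C.
  move=> [/VU[W [[_ WC]|->] DW] [x [Dx Ax]]]; last by have := DW x Dx.
  by apply: subset_trans WC; exact: closureS.
exists (\bigcup_(D in VA) D).
  apply/set_nbhsP; exists (\bigcup_(D in VA) D); split=> //.
    by apply: bigcup_open => D [/oV].
  move=> x Ax; have : setT x by [].
  by rewrite -cV => -[D VD Dx]; exists D => //; split=> //; exists x.
apply: subset_trans CB => b clb.
have [N Nb fN] := lfV b.
pose VN := [set D | VA D /\ D `&` N !=set0].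
have clVN : closed (\bigcup_(D in VN) closure D).
  apply: closed_bigcup => [|D _]; last exact: closed_closure.
  by apply: sub_finite_set fN => D [[]].
have [D [VD _] /(VAC D VD)//] : (\bigcup_(D in VN) closure D) b.
apply: clVN => M Mb; have [x [[D VD Dx] [Mx Nx]]] := clb _ (filterI Mb Nb).
exists x; split=> //; exists D; last exact: subset_closure.
by split => //; exists x.
Qed.

Lemma relatively_compact_cover : exists V : set (set X),
  [/\ V `<=` open, \bigcup_(B in V) B = [set: X],
      (forall B, V B -> compact (closure B)) & locally_finite V].
Proof.
pose U := [set W : set X | open W /\ compact (closure W)].
have [V [oV cV VU lfV]] : exists V : set (set X),
    [/\ V `<=` open, \bigcup_(B in V) B = [set: X],
    (forall B, V B -> exists2 A, U A & B `<=` A) & locally_finite V].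
  apply: (proj2 pcX) => [W []//|]; apply/seteqP; split=> // x _.
  have [W [oW xW _ cW]] :=
    compact_shrink hX lcX (@compact_set1 _ x) openT (@subsetT _ _).
  by exists W => //; exact: xW.
exists V; split=> // B /VU[A [oA cA] BA].
apply: (subclosed_compact _ cA); first exact: closed_closure.
exact: closureS.
Qed.

(** Take the star of A along a locally finite cover by relatively compact open
    sets, and iterate. Each star is sigma-compact because a compact set meets
    finitely many members of the cover. The union of the iterates absorbs every
    member of the cover that it meets, which makes both it and its complement
    open. *)
Lemma sigma_compact_clopen (A : set X) : sigma_compact A ->
  exists M, [/\ open M, closed M, sigma_compact M & A `<=` M].
Proof.
move=> sA; have [V [oV cV cpV lfV]] := relatively_compact_cover.
pose star (D : set X) :=
  \bigcup_(B in [set B | V B /\ B `&` D !=set0]) closure B.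
have sstar D : sigma_compact D -> sigma_compact (star D).
  move=> [K cK DE]; apply: countable_compacts_sigma => [|B [/cpV//]].
  rewrite (_ : mkset _ = \bigcup_n [set B | V B /\ B `&` K n !=set0]).
    apply: bigcup_countable => // n _; apply: finite_set_countable.
    exact: locally_finite_meets_compact.
  apply/seteqP; split=> [B [VB [x [Bx]]]|B [n _ [VB [x [Bx Kx]]]]].
    by rewrite DE => -[n _ Kx]; exists n => //; split=> //; exists x.
  by split=> //; exists x; split=> //; rewrite DE; exists n.
pose D n := iter n star A.
have sD n : sigma_compact (D n) by elim: n => //= n; exact: sstar.
(* The union of the iterated stars contains each member of V that it meets. *)
have VM B x y : V B -> B x -> B y -> (\bigcup_n D n) x -> (\bigcup_n D n) y.
  move=> VB Bx By [n _ Dx]; exists n.+1 => //=.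
  by exists B; [split=> //; exists x|exact: subset_closure].
have cover x : exists2 B, V B & B x.
  by have : setT x by []; rewrite -cV => -[B VB Bx]; exists B.
exists (\bigcup_n D n); split.
- apply: open_forall_nbhs => x Mx; have [B VB Bx] := cover x.
  have : nbhs x B by apply: open_nbhs_nbhs; split => //; exact: oV.
  by apply: filterS => y By; exact: (VM B x).
- move=> x clx; have [B VB Bx] := cover x.
  have /clx[y [My By]] : nbhs x B.
    by apply: open_nbhs_nbhs; split => //; exact: oV.
  exact: (VM B y).
- exact: sigma_compact_bigcup.
- by move=> x Ax; exists 0%N.
Qed.

End paracompact.

(** * The Stone-Cech compactification and the sigma-remainder *)

Section beta_theory.
Variables (R : realType) (X : topologicalType).
Hypotheses (lcX : locally_compact [set: X]) (pcX : paracompact X).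

Let hX : hausdorff_space X := proj1 pcX.
Let crX : completely_regular_space X.
Proof. exact: (@locally_compact_completely_regular X R). Qed.

Local Notation bX := (beta R X).
Local Notation e := (@beta_emb R X).

Let hbX : hausdorff_space bX := @beta_hausdorff R X.

Let closed_compact_beta (K : set bX) : closed K -> compact K.
Proof.
by move=> clK; apply: (subclosed_compact clK (@beta_compact R X)).
Qed.

Lemma beta_locally_compact : locally_compact [set: bX].
Proof.
move=> p _; exists setT; first exact: filterT.
by split; [exact: beta_compact|exact: closedT].
Qed.

Lemma beta_emb_continuous : continuous e.
Proof.
apply/continuousP => B oB.
by rewrite -[open _]/(@open X _) (beta_emb_openE R crX hX); exists B.
Qed.

Lemma beta_emb_nbhs x N : nbhs x N ->
  exists2 D, nbhs (e x) D & e @^-1` D `<=` N.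
Proof.
rewrite nbhsE => -[W [+ Wx] WN]; rewrite (beta_emb_openE R crX hX).
move=> [D oD DW]; exists D; last by rewrite DW.
by apply: open_nbhs_nbhs; split=> //; rewrite -DW in Wx.
Qed.

Lemma closure_beta_emb (A : set X) x : closure (e @` A) (e x) <-> closure A x.
Proof.
split=> [clx N /beta_emb_nbhs[D /clx[_ [[y Ay <-] Dy]] DN]|clx D].
  by exists y; split=> //; exact: DN.
move=> /beta_emb_continuous/clx[y [Ay Dy]].
by exists (e y); split=> //; exists y.
Qed.

Lemma closure_open_beta (W : set bX) : open W ->
  W `<=` closure (e @` (e @^-1` W)).
Proof.
move=> oW p Wp N Np.
have /(_ _ (filterI Np (open_nbhs_nbhs (conj oW Wp))))[] :
    closure (range e) p by rewrite beta_emb_dense.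
by move=> _ [[x _ <-] [Nx Wx]]; exists (e x); split=> //; exists x.
Qed.

Lemma beta_emb_compact (A : set X) : compact (e @` A) <-> compact A.
Proof.
split; first by apply: compact_image_initial; exact: beta_emb_nbhs.
apply: continuous_compact; apply: continuous_subspaceT.
exact: beta_emb_continuous.
Qed.

(** If D is an open neighbourhood of e x whose trace on X lies in a compact set
    K, density puts D inside the closure of e K, which is e K. *)
Lemma open_range_beta_emb : open (range e).
Proof.
apply: open_forall_nbhs => _ [x _ <-].
have [K /beta_emb_nbhs[D Dx DK] cK] := locally_compact_nbhs x hX lcX.
have clK : closed (e @` K).
  by apply: compact_closed => //; exact/beta_emb_compact.
have Dx' : nbhs (e x) D° by exact: nbhs_interior.
apply: filterS Dx' => p /(closure_open_beta (open_interior D)) clp.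
have [y Ky <-] : (e @` K) p; last by exists y.
apply: clK; apply: closureS clp => _ [y /interior_subset/DK Ky <-].
by exists y.
Qed.

Lemma beta_ext_unique (f g : bX -> R) :
  continuous f -> continuous g -> f \o e = g \o e -> f = g.
Proof.
move=> cf cg fg; apply/funext => p; apply/eqP; rewrite -subr_eq0; apply/eqP.
have cfg : continuous (fun q => f q - g q).
  move=> q; apply: (@cvgB _ _ _ _ (@nbhs_filter bX q)); [exact: cf|exact: cg].
have cl0 : closed ((fun q => f q - g q) @^-1` [set 0]).
  apply: preimage_closed => [q _|]; first exact: cfg.
  exact: accessible_closed_set1 (hausdorff_accessible (@Rhausdorff R)) 0.
have : closure (range e) p by rewrite beta_emb_dense.
move=> /(closureS _)/cl0; apply=> _ [x _ <-] /=.
by have /(congr1 (@^~ x)) /= -> := fg; rewrite subrr.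
Qed.

Let continuous_norm (h : bX -> R) :
  continuous h -> continuous (fun p => `|h p|).
Proof.
by move=> ch p; apply: continuous_comp; [exact: ch|exact: norm_continuous].
Qed.

Lemma Cstar_restriction (h : bX -> R) : continuous h -> Cstar R X (h \o e).
Proof.
move=> ch; split.
  by move=> x; apply: continuous_comp; [exact: beta_emb_continuous|exact: ch].
have : compact (range h).
  apply: continuous_compact (@beta_compact R X); exact: continuous_subspaceT.
move=> /compact_bounded[M [Mr hM]]; exists M; split=> // N /hM hN x _ /=.
by apply: hN; exists (e x).
Qed.

(** Normality of X provides a bounded continuous function equal to 0 on A and 1
    on B; its extension keeps these values on the closures. *)
Lemma closure_beta_disjoint (A B : set X) : closed A -> closed B ->
  A `&` B = set0 -> closure (e @` A) `&` closure (e @` B) = set0.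
Proof.
move=> clA clB AB.
have /(@uniform_separatorP _ R)[f [cf f01 f0 f1]] :=
  normal_uniform_separator (paracompact_normal lcX pcX) clA clB AB.
have Cf : Cstar R X f.
  split=> //; exists 1; split=> // M M1 y _ /=.
  have /f01 : range f (f y) by exists y.
  rewrite /= in_itv/= => /andP[fy0 fy1].
  by rewrite ger0_norm// (le_trans fy1)// ltW.
have [g cg gf] := beta_extension Cf.
have gcl (c : R) (D : set X) : f @` D `<=` [set c] ->
    closure (e @` D) `<=` g @^-1` [set c].
  move=> fD; have clc : closed (g @^-1` [set c]).
    apply: preimage_closed => [q _|]; first exact: cg.
    exact: accessible_closed_set1 (hausdorff_accessible (@Rhausdorff R)) c.
  rewrite [X in _ `<=` X](closure_id _).1//; apply: closureS => _ [x Dx <-] /=.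
  by rewrite -[g (e x)]/((g \o e) x) gf; apply: fD; exists x.
apply/seteqP; split=> // p [/(gcl _ _ f0) /= gp /(gcl _ _ f1) /=].
by rewrite gp => /esym/eqP; rewrite oner_eq0.
Qed.

Lemma closure_betaC (A : set X) :
  ~` closure (e @` (~` A)) `<=` closure (e @` A).
Proof.
move=> p nAp; have : closure (range e) p by rewrite beta_emb_dense.
rewrite -(setUv A) image_setU closureU => -[]//.
Qed.

Lemma closure_beta_clopen (M : set X) : open M -> closed M ->
  open (closure (e @` M)).
Proof.
move=> oM clM; rewrite (_ : closure _ = ~` closure (e @` (~` M))).
  exact/closed_openC/closed_closure.
apply/seteqP; split; last exact: closure_betaC.
move=> p Mp Mcp; have := closure_beta_disjoint clM (open_closedC oM) (setICr M).
by move/seteqP => -[/(_ p) + _]; apply.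
Qed.

(** The sets obtained here have open closure in the compactification: they
    exhaust sigma X by open sets, and any compact subset of sigma X already lies
    in one of them. *)
Lemma sigma_ext_clopen (A : set X) : sigma_compact A ->
  exists M, [/\ open (closure (e @` M)), closed M, sigma_compact M & A `<=` M].
Proof.
move=> /(sigma_compact_clopen lcX pcX)[M [oM clM sM AM]].
by exists M; split=> //; exact: closure_beta_clopen.
Qed.

Lemma open_sigma_ext : open (sigma_ext R X).
Proof.
apply: open_forall_nbhs => p [A /sigma_ext_clopen[M [oM _ sM AM]] Ap].
have : nbhs p (closure (e @` M)).
  apply: open_nbhs_nbhs; split=> //; apply: closureS Ap; exact: image_subset.
by apply: filterS => q Mq; exists M.
Qed.

Lemma compact_sigma_ext (D : set bX) : compact D -> D `<=` sigma_ext R X ->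
  exists M, [/\ closed M, sigma_compact M & D `<=` closure (e @` M)].
Proof.
move=> cD Ds; pose P (B : set bX) :=
  exists M, [/\ closed M, sigma_compact M & B `<=` closure (e @` M)].
apply: (compact_ind (P := P) cD) => [|A B|A B AB|p /Ds].
- exists set0; split=> //; first exact: closed0.
  exists (fun=> set0) => [_|]; first exact: compact0.
  by rewrite bigcup0.
- move=> [M [clM sM AM]] [N [clN sN BN]]; exists (M `|` N); split.
  + exact: closedU.
  + rewrite -bigcup2E; apply: sigma_compact_bigcup => -[|[|n]] //=.
    exists (fun=> set0) => [_|]; first exact: compact0.
    by rewrite bigcup0.
  + by rewrite image_setU closureU; exact: setUSS.
- by move=> [M [clM sM BM]]; exists M; split=> //; exact: subset_trans BM.
- move=> [A /sigma_ext_clopen[M [oM clM sM AM]] Ap].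
  exists (closure (e @` M)); last by exists M; split.
  apply: open_nbhs_nbhs; split=> //; apply: closureS Ap; exact: image_subset.
Qed.

Local Notation S := (sigma_remainder R X).

Lemma sigma_remainder_hausdorff : hausdorff_space S.
Proof. exact: hausdorff_set_val. Qed.

Lemma sigma_remainder_locally_compact : locally_compact [set: S].
Proof.
move=> p _; have [sp _] := set_valP p.
have pS : [set set_val p] `<=` sigma_ext R X by move=> _ ->.
have [V [oV Vp VS cV]] := compact_shrink hbX beta_locally_compact
  (@compact_set1 _ _) open_sigma_ext pS.
have cK : compact (set_val @^-1` closure V : set S).
  apply/compact_set_val.
  rewrite (_ : _ @` _ = closure V `&` ~` range e).
    by apply: compact_closedI => //; exact/open_closedC/open_range_beta_emb.
  apply/seteqP; split=> [_ [q Vq <-]|q [Vq nq]].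
    by split=> //; have [] := set_valP q.
  by exists (member (conj (VS q Vq) nq : sigma_remainder R X q)).
exists (set_val @^-1` closure V).
  rewrite within_interior ?interiorT//.
  apply: (@initial_continuous _ bX set_val).
  apply: filterS (@subset_closure _ V) _; apply: open_nbhs_nbhs; split=> //.
  exact: Vp.
by split=> //; apply: compact_closed => //; exact: sigma_remainder_hausdorff.
Qed.

(** * Ideals of regular sequences as vanishing ideals *)

Definition remainder_trace (U : nat -> set X) : set bX :=
  (\bigcap_n closure (e @` U n)) `\` range e.

(** Existence of a vanishing extension is asked for; the extension is unique
    because X is dense in its compactification. *)
Definition vanishing (Z : set bX) : set (X -> R) :=
  [set g | exists2 h : bX -> R, continuous h &
     h \o e = g /\ forall p, Z p -> h p = 0].

(** If a point p of Z2 were outside the closed set Z1, a Urysohn function equal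
    to 0 on Z1 and 1 at p would restrict to a function vanishing on Z1 but not
    on Z2. *)
Lemma vanishing_subset (Z1 Z2 : set bX) : closed Z1 ->
  (vanishing Z1 `<=` vanishing Z2 <-> Z2 `<=` Z1).
Proof.
move=> cl1; split=> [v12 p Z2p|Z21 g [h ch [hg hZ]]]; last first.
  by exists h => //; split=> // p /Z21; exact: hZ.
apply: contrapT => nZ1p.
have clp : closed [set p] by exact/accessible_closed_set1/hausdorff_accessible.
have Z1p : Z1 `&` [set p] = set0.
  by apply/seteqP; split=> // q [Z1q qp]; apply: nZ1p; rewrite -qp.
have nbX : normal_space bX := compact_normal hbX (@beta_compact R X).
have /(@uniform_separatorP _ R)[h [ch _ h0 h1]] :=
  normal_uniform_separator nbX cl1 clp Z1p.
have /v12[h' ch' [hh' h'0]] : vanishing Z1 (h \o e).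
  by exists h => //; split=> // q Z1q; apply: h0; exists q.
have := h'0 p Z2p; rewrite (beta_ext_unique ch' ch hh').
have -> : h p = 1 by apply: h1; exists p.
by move/eqP; rewrite oner_eq0.
Qed.

Section regular_sequence.
Variable U : nat -> set X.
Hypothesis rU : sigma_regular U.

Let U_decr m n : (m <= n)%N -> U n `<=` U m.
Proof.
apply: (@homo_leq _ U (fun A B => B `<=` A)) => [A //|B A C BA CB x /CB/BA//|k].
have [_ _ _ sub] := rU k.
by apply: subset_trans sub; exact: subset_closure.
Qed.

(** The closures of the U n decrease, so a compact set of the remainder that
    misses their intersection misses one of them. The part of K in that closure
    then lies in X, where it is compact. *)
Lemma compact_off_remainder_trace (K : set bX) :
  closed K -> K `&` remainder_trace U = set0 ->
  exists n, compact (e @^-1` K `&` closure (U n)).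
Proof.
move=> clK KU; pose P A := exists n, A `&` closure (e @` U n) = set0.
have cK : compact (K `&` ~` range e).
  apply: closed_compact_beta; apply: closedI => //.
  exact/open_closedC/open_range_beta_emb.
have [|A B|A B AB|p [Kp np]|n nK] := compact_ind (P := P) cK.
- by exists 0%N; rewrite set0I.
- move=> [m Am] [n Bn]; exists (maxn m n).
  apply/seteqP; split=> // p [[Ap|Bp] Up].
    rewrite -Am; split=> //; apply: closureS Up; apply: image_subset.
    by apply: U_decr; exact: leq_maxl.
  rewrite -Bn; split=> //; apply: closureS Up; apply: image_subset.
  by apply: U_decr; exact: leq_maxr.
- move=> [n Bn]; exists n; apply/seteqP; split=> // p [/AB Bp Up].
  by rewrite -Bn.
- have [n nUp] : exists n, ~ closure (e @` U n) p.
    apply/existsNP => Up; suff: set0 p by [].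
    by rewrite -KU; split=> //; split.
  exists (~` closure (e @` U n)); last by exists n; rewrite setICl.
  by apply: open_nbhs_nbhs; split=> //; exact/closed_openC/closed_closure.
exists n; apply/beta_emb_compact.
rewrite (_ : _ @` _ = K `&` closure (e @` U n)).
  by apply: closed_compact_beta; apply: closedI => //; exact: closed_closure.
apply/seteqP; split=> [_ [x [Kx Ux] <-]|p [Kp Up]].
  by split=> //; apply/closure_beta_emb.
(* A point of K in the closure lies in X, since n was chosen so that no point of
   the remainder does both. *)
have [[x _ xp]|np] := pselect (range e p).
  by exists x => //; split; [rewrite /= xp|apply/closure_beta_emb; rewrite xp].
suff: set0 p by [].
by rewrite -nK; split.
Qed.

(** Otherwise the preceding lemma with K the whole space would make some
    closure of U n compact. *)
Lemma remainder_trace_neq0 : remainder_trace U !=set0.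
Proof.
apply/set0P/eqP => U0; have [|n] := @compact_off_remainder_trace setT closedT.
  by rewrite U0 setI0.
by rewrite preimage_setT setTI; have [] := rU n.
Qed.

Lemma closed_remainder_trace : closed (remainder_trace U).
Proof.
apply: closedI; last exact/open_closedC/open_range_beta_emb.
by apply: closed_bigI => n _; exact: closed_closure.
Qed.

Lemma remainder_trace_sub : remainder_trace U `<=` S.
Proof.
move=> p [Up np]; split=> //; exists (closure (U 0%N)).
  by have [] := rU 0%N.
by apply: closureS (Up 0%N I); apply: image_subset; exact: subset_closure.
Qed.

(** The closure of U n.+1 and the complement of U n are disjoint closed sets, so
    their closures in the compactification are disjoint. Hence the complement of
    the closure of e (~` U n) is an open set squeezed between the closures of
    e (U n.+1) and e (U n), and the trace is the intersection of these open
    sets with the remainder. *)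
Lemma compact_Gdelta_remainder_trace :
  compact_Gdelta S (set_val @^-1` remainder_trace U).
Proof.
have vE := set_val_imageK remainder_trace_sub.
split.
- have [p Up] := remainder_trace_neq0; exists (member (remainder_trace_sub Up)).
  exact: Up.
- apply/compact_set_val; rewrite vE.
  exact/closed_compact_beta/closed_remainder_trace.
- exists (fun n => set_val @^-1` (~` closure (e @` (~` U n)))).
    move=> n; exists (~` closure (e @` (~` U n))) => //.
    exact/closed_openC/closed_closure.
  apply/seteqP; split=> [p [Up _] n _ /= nUp|p Up].
    have [oU _ _ sub] := rU n.
    have dis : closure (U n.+1) `&` ~` U n = set0.
      by apply/disjoints_subset; rewrite setCK.
    have := closure_beta_disjoint (@closed_closure _ _) (open_closedC oU) dis.
    move/seteqP => -[/(_ (set_val p)) + _]; apply; split=> //.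
    apply: closureS (Up n.+1 I); apply: image_subset; exact: subset_closure.
  split; last by have [] := set_valP p.
  by move=> n _; apply: closure_betaC; exact: Up.
Qed.

(** The compactness condition defining the ideal says that the set where the
    extension is at least eps in absolute value misses the trace. *)
Lemma ideal_of_vanishing : ideal_of U = vanishing (remainder_trace U).
Proof.
apply/seteqP; split=> g.
  move=> [Cg gU]; have [h ch hg] := beta_extension Cg.
  exists h => //; split=> // p [Up np]; apply: contrapT => /eqP hp0.
  have hp : 0 < `|h p| / 2 by rewrite divr_gt0// normr_gt0.
  have [n cC] := gU _ hp.
  set C := (X in compact X) in cC.
  have clC : closed (e @` C).
    by apply: compact_closed => //; exact/beta_emb_compact.
  (* Near p the extension stays above half of its absolute value at p while the
     compact set C is avoided; yet p is a limit of points of U n. *)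
  have nCp : ~ (e @` C) p by move=> [x _ xp]; apply: np; exists x.
  have near1 : nbhs p (~` (e @` C)).
    by apply: open_nbhs_nbhs; split=> //; exact: closed_openC.
  have near2 : nbhs p [set q | `|h p| / 2 < `|h q|].
    have : (fun q => `|h q|) @ p --> `|h p| by exact: continuous_norm.
    move/cvgr_gt; apply; rewrite ltr_pdivrMr// mulr_natr mulr2n ltrDl.
    by rewrite normr_gt0.
  have [_ [[x Ux <-] [nCx /ltW hx]]] := Up n I _ (filterI near1 near2).
  apply: nCx; exists x => //; split; last exact: subset_closure.
  by rewrite /= -hg.
move=> [h ch [<- hU]]; split; first exact: Cstar_restriction.
move=> eps eps0; apply: (@compact_off_remainder_trace [set p | eps <= `|h p|]).
  rewrite (_ : mkset _ = (fun p => `|h p|) @^-1` [set r | eps <= r])//.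
  apply: preimage_closed; last exact: closed_ge.
  by move=> p _; exact: continuous_norm.
apply/seteqP; split=> // p [/= hp /hU h0].
by move: hp; rewrite h0 normr0 leNgt eps0.
Qed.

End regular_sequence.

(** Shrink open neighbourhoods V n of Z in the compactification, inside sigma X
    and inside the open sets whose intersection is Z, and take U n to be the
    part of V n in X. Compactness of the closure of V n inside sigma X makes the
    closure of U n sigma-compact; a point of Z is a limit of U n outside X, so
    that closure is not compact. *)
Lemma compact_Gdelta_is_remainder_trace (Z : set S) : compact_Gdelta S Z ->
  exists2 U, sigma_regular U & remainder_trace U = set_val @` Z.
Proof.
move=> [[z Zz] /compact_set_val cZ [W oW ZE]].
have A_ n : exists A : set bX, open A /\ set_val @^-1` A = W n.
  by have [A oA AW] := oW n; exists A.
pose A n := projT1 (cid (A_ n)).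
have [oA AW] : (forall n, open (A n)) /\ forall n, set_val @^-1` A n = W n.
  by split=> n; have [] := projT2 (cid (A_ n)).
have oAs n : open (A n `&` sigma_ext R X).
  by apply: openI => //; exact: open_sigma_ext.
have ZA n : set_val @` Z `<=` A n `&` sigma_ext R X.
  move=> _ [p Zp <-]; split; last by have [] := set_valP p.
  have : W n p by move: Zp; rewrite ZE; exact.
  by rewrite -AW.
have [V VP] := shrinking_sequence hbX beta_locally_compact cZ oAs ZA.
pose U n := e @^-1` V n.
have clU n : closure (e @` U n) `<=` closure (V n).
  by apply: closureS => _ [x Vx <-].
exists U.
  move=> n; have [oV ZV VA cV VV] := VP n.
  have clUV : closure (U n) `<=` e @^-1` closure (V n).
    by move=> x /closure_beta_emb/clU.
  split.
  - by apply: open_comp => // x _; exact: beta_emb_continuous.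
  - have [|M [clM sM VM]] := compact_sigma_ext cV; first by move=> p /VA[].
    apply: (sigma_compact_closedI sM); first exact: closed_closure.
    move=> x /clUV/VM/closure_beta_emb; exact: clM.
  - move=> /beta_emb_compact/(compact_closed hbX) clUe.
    have [_ nz] := set_valP z; apply: nz.
    have [x _ xz] : (e @` closure (U n)) (set_val z); last by exists x.
    have Vz : V n (set_val z) by apply: ZV; exists z.
    apply: clUe; apply: closureS (closure_open_beta oV Vz).
    by apply: image_subset; exact: subset_closure.
  - have [_ _ _ _ VV1] := VP n.
    by move=> x /closure_beta_emb/clU/VV.
apply/seteqP; split=> [p [Up np]|_ [p Zp <-]].
  have Vp n : (A n `&` sigma_ext R X) p.
    by have [_ _ VA _ _] := VP n; exact/VA/clU/Up.
  have [_ sp] := Vp 0%N.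
  exists (member (conj sp np : sigma_remainder R X p)) => //.
  rewrite ZE => n _; rewrite -AW.
  by have [] := Vp n.
split; last by have [] := set_valP p.
move=> n _; have [oV ZV _ _ _] := VP n.
by apply: closure_open_beta => //; apply: ZV; exists p.
Qed.

Lemma Omega_vanishing :
  Omega R X = (fun Z : set S => vanishing (set_val @` Z)) @` compact_Gdelta S.
Proof.
apply/seteqP; split=> [_ [U rU ->]|_ [Z cZ <-]].
  exists (set_val @^-1` remainder_trace U).
    exact: compact_Gdelta_remainder_trace.
  by rewrite set_val_imageK ?ideal_of_vanishing//; exact: remainder_trace_sub.
have [U rU <-] := compact_Gdelta_is_remainder_trace cZ.
by exists U => //; rewrite ideal_of_vanishing.
Qed.

(** The order isomorphism reverses inclusion: larger sets have smaller vanishing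
    ideals. *)
Lemma Omega_compact_Gdelta : order_isomorphic
  (@sub_le _ (compact_Gdelta S)) (fun I J : Omega R X => Omega_le J I).
Proof.
apply: (antitone_image_isomorphic Omega_vanishing).
move=> A B [_ /compact_set_val cA _] _.
split=> [/vanishing_subset BA p Bp|BA].
  have /BA[|q Aq /val_inj <-//] : (set_val @` B) (set_val p) by exists p.
  exact: compact_closed.
apply/vanishing_subset; first exact: compact_closed.
exact: image_subset.
Qed.

End beta_theory.

(** * The ordered set of ideals determines the sigma-remainder *)

Theorem theorem7p10 (R : realType) (X Y : topologicalType)
    (lcX : locally_compact [set: X]) (pcX : paracompact X)
    (nscX : ~ sigma_compact [set: X])
    (lcY : locally_compact [set: Y]) (pcY : paracompact Y)
    (nscY : ~ sigma_compact [set: Y]) :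
  order_isomorphic (@Omega_le R X) (@Omega_le R Y) <->
  homeomorphic (sigma_remainder R X) (sigma_remainder R Y).
Proof.
have OX := Omega_compact_Gdelta R lcX pcX.
have OY := Omega_compact_Gdelta R lcY pcY.
split=> [/order_isomorphic_dual OXY|/homeomorphic_compact_Gdelta SXY].
  apply: compact_Gdelta_homeomorphic.
  - exact: sigma_remainder_hausdorff.
  - exact: sigma_remainder_locally_compact.
  - exact: sigma_remainder_hausdorff.
  - exact: sigma_remainder_locally_compact.
  - apply: order_isomorphic_trans OX _; apply: order_isomorphic_trans OXY _.
    exact: order_isomorphic_sym.
apply: order_isomorphic_dual.
apply: order_isomorphic_trans (order_isomorphic_sym OX) _.
exact: order_isomorphic_trans SXY OY.
Qed.
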